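(* Let $r\ge 2$ be an integer, and let $Y$, $Y_0$, $d$, $\rho$, $D$ and $A:\mathbf{R}\times Y_0\to Y$ be as defined in the context. Then $$d(A(a,x),A(b,y))\le 2\pi\, D((a,x),(b,y))\qquad\text{for all }(a,x),(b,y)\in\mathbf{R}\times Y_0 .$$ Moreover, there is a positive real number $c_2(r)$, depending only on $r$, such that $$D((a,x),(b,y))\le c_2(r)\, d(A(a,x),A(b,y))$$ for all $(a,x),(b,y)\in\mathbf{R}\times Y_0$ with $|a-b|\le 1/2$.
   Context: Fix an integer $r\ge 2$. Let $X=\prod_{l=0}^\infty(\mathbf{R}/r^l\mathbf{Z})$, a commutative group under coordinatewise addition. A sequence $x=\{x_l\}_{l=0}^\infty\in X$ is coherent if, for each $l\ge 0$, $x_l$ is the image of $x_{l+1}$ under the natural homomorphism $\mathbf{R}/r^{l+1}\mathbf{Z}\to\mathbf{R}/r^l\mathbf{Z}$. Let $Y\subseteq X$ be the subgroup of coherent sequences. Let $\phi_l:\mathbf{R}/r^l\mathbf{Z}\to\{z\in\mathbf{C}:|z|=1\}$ be the isomorphism induced by $a\mapsto\exp(2\pi i r^{-l}a)$. The metric $d$ on $X$ (and, by restriction, on $Y$) is $d(x,y)=\max_{l\ge 0} r^{-l}|\phi_l(x_l)-\phi_l(y_l)|$. Let $Y_0$ be the set of coherent sequences in $X_0=\prod_{l=1}^\infty(\mathbf{Z}/r^l\mathbf{Z})$, that is, sequences $\{x_l\}_{l=1}^\infty$ such that $x_l$ is the image of $x_{l+1}$ under $\mathbf{Z}/r^{l+1}\mathbf{Z}\to\mathbf{Z}/r^l\mathbf{Z}$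 for each $l\ge 1$. Identify $Y_0$ with the subgroup $\{y\in Y: y_0=0\}$ of $Y$ by setting $x_0=0$ in $\mathbf{R}/\mathbf{Z}$. For distinct $x,y\in X_0$, let $l(x,y)$ be the smallest positive integer $l$ with $x_l\ne y_l$, and put $\rho(x,y)=r^{-l(x,y)+1}$; put $\rho(x,x)=0$. This is an ultrametric. Let $q:\mathbf{R}\to Y$ be the homomorphism $q(a)=\{q_l(a)\}_{l=0}^\infty$, where $q_l:\mathbf{R}\to\mathbf{R}/r^l\mathbf{Z}$ is the quotient map. Define $A:\mathbf{R}\times Y_0\to Y$ by $A(a,x)=q(a)+x$, the sum being taken in $Y$. The metric $D$ on $\mathbf{R}\times Y_0$ is $D((a,x),(b,y))=\max(|a-b|,\rho(x,y))$. *)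

(* Defs.v *)
From HB Require Import structures.
From mathcomp Require Import all_boot all_order all_algebra.
From mathcomp Require Import generic_quotient ring_quotient complex.
From mathcomp Require Import all_classical all_reals all_analysis.

Set Implicit Arguments.
Unset Strict Implicit.
Unset Printing Implicit Defensive.

Import Order.TTheory GRing.Theory Num.Theory.
Import Quotient.

Local Open Scope classical_set_scope.
Local Open Scope ring_scope.
Local Open Scope quotient_scope.

(** * The cyclic subgroup [m Z] of an additive group and the quotient by it *)

Definition zspan (T : zmodType) (m : T) : {pred T} :=
  fun x => `[< exists k : int, x = m *~ k >].

Lemma zspan_closed (T : zmodType) (m : T) : zmod_closed (zspan m).
Proof.
split; first by apply/asboolP; exists 0; rewrite mulr0z.
move=> x y /asboolP[j ->] /asboolP[k ->].
by apply/asboolP; exists (j - k); rewrite mulrzBr.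
Qed.

HB.instance Definition _ (T : zmodType) (m : T) :=
  GRing.isZmodClosed.Build T (zspan m) (zspan_closed m).

Notation modZ m := (Quotient.quot (zspan m)).

(* The map [T / m Z -> T' / m' Z] induced by [f : T -> T'].  It is the
   intended homomorphism as soon as [f] is additive and sends [m] into
   [m' Z], see [qmap_pi]. *)
Definition qmap (T T' : zmodType) (m : T) (m' : T') (f : T -> T')
  (x : modZ m) : modZ m' := \pi_(modZ m') (f (repr x)).

Lemma eq_modZP (T : zmodType) (m x y : T) :
  reflect (exists k : int, x - y = m *~ k)
          (\pi_(modZ m) x == \pi_(modZ m) y).
Proof. by rewrite -idealrBE; apply: asboolP. Qed.

Lemma qmap_pi (T T' : zmodType) (m : T) (m' : T') (f : {additive T -> T'})
    (a : T) : f m \in zspan m' ->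
  qmap m' f (\pi_(modZ m) a) = \pi_(modZ m') (f a).
Proof.
move=> /asboolP[j fm]; apply/eqP/eq_modZP.
have /eqP/eq_modZP[k ak] : \pi_(modZ m) (repr (\pi_(modZ m) a)) = \pi_(modZ m) a.
  by rewrite reprK.
by exists (j * k); rewrite -raddfB ak raddfMz fm mulrzA.
Qed.

(** * The groups [X] and [Y] *)

Section Solenoid.
Variables (R : realType) (r : nat).

Definition X := forall l : nat, modZ (r%:R ^+ l : R).

HB.instance Definition _ := Choice.on X.

Definition X_zero : X := fun l => 0.
Definition X_opp (x : X) : X := fun l => - x l.
Definition X_add (x y : X) : X := fun l => x l + y l.

Lemma X_addA : associative X_add.
Proof. by move=> x y z; apply: functional_extensionality_dep => l; apply: addrA. Qed.
Lemma X_addC : commutative X_add.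
Proof. by move=> x y; apply: functional_extensionality_dep => l; apply: addrC. Qed.
Lemma X_add0 : left_id X_zero X_add.
Proof. by move=> x; apply: functional_extensionality_dep => l; apply: add0r. Qed.
Lemma X_addN : left_inverse X_zero X_opp X_add.
Proof. by move=> x; apply: functional_extensionality_dep => l; apply: addNr. Qed.

HB.instance Definition _ :=
  GRing.isZmodule.Build X X_addA X_addC X_add0 X_addN.

(* the natural homomorphism [R / r^(l+1) Z -> R / r^l Z] *)
Definition red (l : nat) : modZ (r%:R ^+ l.+1 : R) -> modZ (r%:R ^+ l : R) :=
  qmap (r%:R ^+ l) idfun.

Lemma red_pi l (a : R) :
  red (\pi_(modZ (r%:R ^+ l.+1 : R)) a) = \pi_(modZ (r%:R ^+ l : R)) a.
Proof.
apply: (@qmap_pi _ _ _ _ (idfun : {additive R -> R})).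
by apply/asboolP; exists r%:Z; rewrite /= exprSr mulr_natr.
Qed.

Lemma red_zmod_morphism l : zmod_morphism (@red l).
Proof.
move=> u v; rewrite -[u]reprK -[v]reprK !red_pi.
by rewrite -!raddfB red_pi.
Qed.

Definition coherent : {pred X} := fun x => `[< forall l, x l = red (x l.+1) >].

Lemma coherent_closed : zmod_closed coherent.
Proof.
split; first by apply/asboolP => l; rewrite -[X in _ = red X](raddf0 \pi) red_pi raddf0.
move=> x y /asboolP hx /asboolP hy; apply/asboolP => l.
by rewrite red_zmod_morphism -hx -hy.
Qed.

HB.instance Definition _ := GRing.isZmodClosed.Build X coherent coherent_closed.

Record Y := MkY { Yval :> X ; _ : Yval \in coherent }.

HB.instance Definition _ := [isSub for Yval].
HB.instance Definition _ := [Choice of Y by <:].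
HB.instance Definition _ := [SubChoice_isSubZmodule of Y by <:].

(* [phi_l], induced by [a |-> exp (2 pi i r^-l a)]; [phi_pi] below is its
   compatibility with the quotient *)
Definition phi_lift (l : nat) (a : R) : R[i] :=
  let t := 2 * pi * (r%:R ^- l * a) in (cos t +i* sin t)%C.

Definition phi (l : nat) (x : modZ (r%:R ^+ l : R)) : R[i] :=
  phi_lift l (repr x).

Lemma phi_lift_period (hr : (0 < r)%N) l (a : R) (k : int) :
  phi_lift l (a + r%:R ^+ l *~ k) = phi_lift l a.
Proof.
have r0 : r%:R ^+ l != 0 :> R by rewrite expf_neq0// pnatr_eq0 -lt0n.
have pos (b : R) (n : nat) : phi_lift l (b + r%:R ^+ l *+ n) = phi_lift l b.
  rewrite /phi_lift.
  have -> : 2 * pi * (r%:R ^- l * (b + r%:R ^+ l *+ n)) =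
      2 * pi * (r%:R ^- l * b) + (pi *+ 2) *+ n :> R.
    rewrite -[r%:R ^+ l *+ n]mulr_natr -[pi *+ 2 *+ n]mulr_natr -[pi *+ 2]mulr_natl.
    by rewrite [r%:R ^- l * (_ + _)]mulrDr (mulKf r0) mulrDr.
  by rewrite (periodicn (@cosD2pi R)) (periodicn (@sinD2pi R)).
case: k => n; first exact: pos.
by rewrite NegzE mulrNz -[in RHS](subrK (r%:R ^+ l *+ n.+1) a) pos.
Qed.

Lemma phi_pi (hr : (0 < r)%N) l (a : R) :
  phi (\pi_(modZ (r%:R ^+ l : R)) a) = phi_lift l a.
Proof.
rewrite /phi.
have /eqP/eq_modZP[k ak] : \pi_(modZ (r%:R ^+ l : R))
    (repr (\pi_(modZ (r%:R ^+ l : R)) a)) = \pi_(modZ (r%:R ^+ l : R)) a.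
  by rewrite reprK.
by rewrite -[repr _](subrK a) ak addrC phi_lift_period.
Qed.

(* For [r >= 2] the terms are bounded by [2 r^-l], so the supremum is a
   maximum: see [d_max]. *)
Definition d_term (x y : X) (l : nat) : R :=
  r%:R ^- l * Normc.normc (phi (x l) - phi (y l)).

Definition d (x y : X) : R := sup (range (d_term x y)).

Lemma d_term_ge0 x y l : 0 <= d_term x y l.
Proof.
rewrite mulr_ge0 ?invr_ge0 ?exprn_ge0//.
by case: (phi (x l) - phi (y l)) => u v; apply: sqrtr_ge0.
Qed.

Lemma normc_phi l (u : modZ (r%:R ^+ l : R)) : Normc.normc (phi u) = 1.
Proof. by rewrite /= cos2Dsin2 sqrtr1. Qed.

Lemma d_term_le x y l : d_term x y l <= 2 * r%:R ^- l.
Proof.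
rewrite /d_term mulrC ler_wpM2r ?invr_ge0 ?exprn_ge0//.
apply: le_trans (le_normcD _ _) _.
by rewrite normcN !normc_phi.
Qed.

Lemma d_max (hr : (2 <= r)%N) x y :
  exists l, d x y = d_term x y l /\ forall k, d_term x y k <= d_term x y l.
Proof.
suff [l hl] : exists l, forall k, d_term x y k <= d_term x y l.
  exists l; split => //; apply/eqP; rewrite eq_le; apply/andP; split.
    by apply: ge_sup => [|_ [k _ <-]]; [exists (d_term x y l), l|exact: hl].
  by apply: ub_le_sup; [exists (d_term x y l) => _ [k _ <-]|exists l].
case: (pselect (forall k, d_term x y k <= 0)) => [h0|].
  by exists 0%N => k; rewrite (le_trans (h0 k)) ?d_term_ge0.
move/existsNP => [m /negP]; rewrite -ltNge => hm.
have [n hn] : exists n, forall k, (n <= k)%N -> d_term x y k <= d_term x y m.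
  have r1 : `|r%:R^-1 : R| < 1.
    by rewrite ger0_norm ?invr_ge0// invf_lt1 ?ltr1n// ltr0n ltnW.
  have := cvg_expr r1.
  move/cvgrPdist_lt => /(_ _ (divr_gt0 hm (ltr0n R 2))) [n _ hn].
  exists n => k nk; apply: le_trans (d_term_le _ _ _) _.
  have := hn k nk; rewrite /= sub0r normrN ger0_norm ?exprn_ge0 ?invr_ge0//.
  by rewrite exprVn ltr_pdivlMr// mulrC => /ltW.
pose i := [arg max_(i > inord m : 'I_(n + m).+1) d_term x y i]%O.
exists i => k.
rewrite /i; case: arg_maxP => //= j _ hj.
have [kn|nk] := ltnP k (n + m).+1; first exact: (hj (Ordinal kn) isT).
apply: le_trans (hn k _) _.
  by rewrite (leq_trans _ (ltnW nk))// leq_addr.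
by have := hj (inord m) isT; rewrite inordK// ltnS leq_addl.
Qed.

(** * The ultrametric space [Y0] of r-adic integers *)

(* Coordinates are numbered from 1 in the mathematical definition: here
   [x l] is the coordinate of index [l + 1]. *)
Definition X0 := forall l : nat, modZ (r%:R ^+ l.+1 : int).

Definition red0 (l : nat) :
    modZ (r%:R ^+ l.+2 : int) -> modZ (r%:R ^+ l.+1 : int) :=
  qmap (r%:R ^+ l.+1) idfun.

Definition coherent0 (x : X0) : Prop := forall l, x l = red0 (x l.+1).

Record Y0 := MkY0 { Y0val :> X0 ; Y0P : coherent0 Y0val }.

(* the smallest positive index at which [x] and [y] differ (0 if [x = y]) *)
Definition ldiff (x y : X0) : nat :=
  if pselect (exists l, x l != y l) is left h then (ex_minn h).+1 else 0.

Definition rho (x y : X0) : R :=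
  if `[< x = y >] then 0 else r%:R ^ (1 - (ldiff x y)%:Z).

(** * The map [A] *)

(* the homomorphism [Z / r^l Z -> R / r^l Z] induced by [Z -> R] *)
Definition incl (l : nat) : modZ (r%:R ^+ l : int) -> modZ (r%:R ^+ l : R) :=
  qmap (r%:R ^+ l) intr.

Lemma incl_pi l (a : int) :
  incl (\pi_(modZ (r%:R ^+ l : int)) a) = \pi_(modZ (r%:R ^+ l : R)) a%:~R.
Proof.
apply: (@qmap_pi _ _ _ _ (intr : {additive int -> R})).
by apply/asboolP; exists 1; rewrite mulr1z /= rmorphXn /= rmorph_nat.
Qed.

Definition iota_fun (x : X0) : X :=
  fun l => if l is l'.+1 then incl (x l') else 0.

Lemma red0_pi l (a : int) :
  red0 (\pi_(modZ (r%:R ^+ l.+2 : int)) a) = \pi_(modZ (r%:R ^+ l.+1 : int)) a.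
Proof.
apply: (@qmap_pi _ _ _ _ (idfun : {additive int -> int})).
by apply/asboolP; exists r%:Z; rewrite /= [_ ^+ l.+2]exprSr mulr_natr.
Qed.

Lemma iota_coherent (x : Y0) : iota_fun x \in coherent.
Proof.
apply/asboolP => -[|l] /=.
  rewrite -[(x : X0) 0%N]reprK incl_pi red_pi -[LHS](raddf0 \pi); apply/eqP/eq_modZP.
  by exists (- repr ((x : X0) 0%N)); rewrite sub0r expr0 mulrNz.
rewrite (Y0P x l) -[(x : X0) l.+1]reprK red0_pi !incl_pi red_pi.
by [].
Qed.

(* the identification of [Y0] with the subgroup [{y in Y : y_0 = 0}] *)
Definition iota (x : Y0) : Y := MkY (iota_coherent x).

Lemma intr_expMz l (k : int) :
  (r%:R ^+ l *~ k : int)%:~R = r%:R ^+ l *~ k :> R.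
Proof. by rewrite rmorphMz /= rmorphXn /= rmorph_nat. Qed.

Lemma iota_inj : injective iota.
Proof.
move=> [x hx] [y hy] /(congr1 (fun z : Y => Yval z)) /= e.
have xy : x = y.
  apply: functional_extensionality_dep => l.
  have := congr1 (fun z : X => z l.+1) e.
  rewrite /= -[x l]reprK -[y l]reprK !incl_pi => /eqP/eq_modZP[k].
  rewrite -rmorphB -intr_expMz => /intr_inj h.
  by apply/eqP/eq_modZP; exists k.
by subst y; congr MkY0; apply: Prop_irrelevance.
Qed.

Lemma iota_image (y : Y) : (exists x, iota x = y) <-> (y : X) 0%N = 0.
Proof.
split=> [[x <-] //|y0].
have cy : forall l, Yval y l = red (Yval y l.+1) by apply/asboolP; exact: (valP y).
have int_repr l : exists k : int, repr (Yval y l) = k%:~R.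
  elim: l => [|l [k hk]].
    have : \pi_(modZ (r%:R ^+ 0 : R)) (repr (Yval y 0%N)) = \pi_(modZ (r%:R ^+ 0 : R)) 0.
      by rewrite reprK y0 raddf0.
    by move=> /eqP/eq_modZP[k]; rewrite subr0 => ->; exists k.
  have : \pi_(modZ (r%:R ^+ l : R)) (repr (Yval y l.+1)) =
         \pi_(modZ (r%:R ^+ l : R)) (repr (Yval y l)).
    by rewrite -red_pi !reprK -cy.
  move=> /eqP/eq_modZP[j] /eqP; rewrite subr_eq hk => /eqP ->.
  exists (r%:R ^+ l *~ j + k).
  by rewrite rmorphD /= intr_expMz.
have [f hf] := choice int_repr.
pose x : X0 := fun l => \pi_(modZ (r%:R ^+ l.+1 : int)) (f l.+1).
have yf l : Yval y l = \pi_(modZ (r%:R ^+ l : R)) (f l)%:~R by rewrite -hf reprK.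
have hx : coherent0 x.
  move=> l; rewrite /x red0_pi.
  have := cy l.+1; rewrite !yf red_pi => /eqP/eq_modZP[k].
  rewrite -rmorphB -intr_expMz => /intr_inj h.
  by apply/eqP/eq_modZP; exists k.
exists (MkY0 hx); apply: val_inj; apply: functional_extensionality_dep.
by move=> [|l] /=; [rewrite y0|rewrite /x incl_pi yf].
Qed.

Definition q_fun (a : R) : X := fun l => \pi_(modZ (r%:R ^+ l : R)) a.

Lemma q_coherent (a : R) : q_fun a \in coherent.
Proof. by apply/asboolP => l; rewrite red_pi. Qed.

Definition q (a : R) : Y := MkY (q_coherent a).

Definition A (p : R * Y0) : Y := q p.1 + iota p.2.

Definition D (p p' : R * Y0) : R :=
  Num.max `|p.1 - p'.1| (rho p.2 p'.2).

End Solenoid.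

(* Main.v *)
Require Import Defs.
From HB Require Import structures.
From mathcomp Require Import all_boot all_order all_algebra.
From mathcomp Require Import generic_quotient ring_quotient complex ring lra.
From mathcomp Require Import all_classical all_reals all_analysis.
Import Order.TTheory GRing.Theory Num.Theory.
Local Open Scope ring_scope.
Local Open Scope quotient_scope.

(** Write the coordinates of [A (a, x)] and [A (b, y)] at level [l] as the
  classes of the reals [a + n] and [b + m] with [n] and [m] integers.  The
  chord between two points of the unit circle is twice the absolute sine of
  half their angle, so the [l]-th term of [d] is
  [2 r^-l |sin (pi r^-l (a - b + n - m))|] ([d_term_pi], [A_coord]).

  Upper bound.  At a level where [x] and [y] agree one may take [n = m], and
  [|sin t| <= |t|] bounds the term by [2 pi |a - b|] ([d_term_agree]).  If [h]
  is the first index with [x h <> y h], that is, the level [h + 1], then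
  [rho x y = r^-h], and the levels beyond [h] contribute at most [2 r^-h]
  because a chord has length at most 2 ([d_term_le_max]).

  Lower bound.  On [|s| <= 1/2] one has [|s| <= |sin (pi s)|]
  ([norm_sin_pi_ge]).  Level 0, where [n = m = 0], then controls [|a - b|]
  ([dist_le_d]).  At level [h + 1] the integer [n - m] is, by coherence, a
  multiple of [r^h], and it is nonzero for every choice of representatives; so
  it has absolute value at least [r^h], which the perturbation
  [|a - b| <= 1/2] can at most halve.  Hence [r^-(h+1) (a - b + n - m)] has
  distance at least [1 / (2 r)] from the integers, and this level alone gives
  [d >= r^-(h+2)], so that [r^-h <= r^2 d] ([expn_le_d]).  The constant [r^2]
  serves for both parts of [D]. *)

(** * Elementary bounds for the sine *)

Section SineMeanValue.
Import numFieldNormedType.Exports.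

Lemma sin_mean_value (R : realType) (y : R) : 0 <= y ->
  exists2 c, 0 <= c <= y & sin y = cos c * y.
Proof.
move=> y0.
have [|c] := @MVT_segment R sin cos 0 y y0 (fun x _ => is_derive_sin x).
  exact/continuous_subspaceT/continuous_sin.
by rewrite in_itv /= sin0 !subr0 => cy e; exists c.
Qed.

End SineMeanValue.

Lemma sin_le_id (R : realType) (y : R) : 0 <= y -> sin y <= y.
Proof.
move=> y0; have [c _ ->] := sin_mean_value _ _ y0.
by rewrite ler_piMl ?cos_le1.
Qed.

Lemma norm_sin_le (R : realType) (y : R) : `|sin y| <= `|y|.
Proof.
wlog y0 : y / 0 <= y => [H|].
  by case/orP: (le_total 0 y) => y0; [|rewrite -normrN -sinN -[`|y|]normrN];
    apply: H => //; rewrite oppr_ge0.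
rewrite [leRHS]ger0_norm// ler_norml sin_le_id// andbT.
have [yp|yp] := leP y pi.
  by apply: (@le_trans _ _ 0); rewrite ?oppr_le0// sin_ge0_pi ?y0.
apply: (@le_trans _ _ (-1)); last exact: sin_geN1.
by rewrite lerN2; have := pi_ge2 R; lra.
Qed.

(** Doubling an angle turns the crude bound [sin y >= y cos y] into
  [sin x >= x (cos (x/2))^2 = x (1 + cos x) / 2], and [cos x >= 0] here. *)
Lemma sin_ge_half (R : realType) (x : R) : 0 <= x <= pi / 2 -> x / 2 <= sin x.
Proof.
move=> /andP[x0 xp].
have y0 : 0 <= x / 2 by lra.
have [c /andP[c0 cy] e] := sin_mean_value _ _ y0.
have p2 := pi_ge2 R.
have cosc : cos (x / 2) <= cos c.
  by rewrite leNgt ltr_cos ?in_itv /= -?leNgt//; apply/andP; split; lra.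
have cos0 : 0 <= cos (x / 2) by apply: cos_ge0_pihalf; apply/andP; split; lra.
have cosx : 0 <= cos x by apply: cos_ge0_pihalf; apply/andP; split; lra.
have xE : x = (x / 2) *+ 2 by rewrite mulr2n; lra.
have cos2 := cos_mulr2n (x / 2); have sin2 := sin_mulr2n (x / 2).
rewrite -xE in cos2 sin2; rewrite sin2 e.
have : cos (x / 2) * (cos (x / 2) * (x / 2)) <= cos (x / 2) * (cos c * (x / 2)).
  by rewrite ler_wpM2l// ler_wpM2r.
have : (1 / 2) * (x / 2) <= cos (x / 2) ^+ 2 * (x / 2) by rewrite ler_wpM2r//; lra.
rewrite expr2; lra.
Qed.

(** A form of Jordan's inequality.  The optimal factor on the left is 2; a
  factor 1 only affects the value of the constant in the lower bound. *)
Lemma norm_sin_pi_ge (R : realType) (s : R) : `|s| <= 1 / 2 -> `|s| <= `|sin (pi * s)|.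
Proof.
wlog s0 : s / 0 <= s => [H|].
  by case/orP: (le_total 0 s) => s0; [|rewrite -[`|sin _|]normrN -sinN -[`|s|]normrN -mulrN];
    apply: H => //; rewrite oppr_ge0.
rewrite (ger0_norm s0) => s1.
have p2 := pi_ge2 R.
have ps_le : pi * s <= pi * (1 / 2) by rewrite ler_wpM2l; lra.
have ps_ge : 2 * s <= pi * s by rewrite ler_wpM2r.
have /sin_ge_half : 0 <= pi * s <= pi / 2 by apply/andP; split; lra.
by have := ler_norm (sin (pi * s)); lra.
Qed.

Lemma chordE (R : realType) (u v : R) :
  Normc.normc ((cos u +i* sin u) - (cos v +i* sin v))%C = 2 * `|sin ((u - v) / 2)|.
Proof.
rewrite /= (_ : 2 * _ = `|2 * sin ((u - v) / 2)|); last by rewrite normrM ger0_norm.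
rewrite -sqrtr_sqr; congr Num.sqrt.
have h : cos (u - v) = 1 - 2 * sin ((u - v) / 2) ^+ 2.
  rewrite [X in cos X](_ : _ = ((u - v) / 2) *+ 2); last by rewrite mulr2n; lra.
  by rewrite cos_mulr2n; have := cos2Dsin2 ((u - v) / 2); lra.
move: h; rewrite cosB.
have := cos2Dsin2 u; have := cos2Dsin2 v.
move: (sin ((u - v) / 2)) => s.
lra.
Qed.

Lemma exists_nearest_int (R : realType) (u : R) : exists k : int, `|u - k%:~R| <= 1 / 2.
Proof.
exists (Num.floor (u + 1 / 2)).
have := floor_itv (u + 1/2); rewrite intrD1 => /andP[h1 h2].
rewrite ler_norml; lra.
Qed.

(** * The terms of the distance [d] *)

Section Estimates.
Context (R : realType) (r : nat) (hr : (2 <= r)%N).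
Implicit Types (x y : Y0 r) (a b : R).

Let r_gt0 : (0 < r)%N. Proof. exact: ltnW. Qed.
Let rR_gt0 : 0 < r%:R :> R. Proof. by rewrite ltr0n. Qed.
Let rR_ge1 : 1 <= r%:R :> R. Proof. by rewrite ler1n. Qed.

Lemma d_term_pi (u v : X R r) l (s t : R) :
  u l = \pi s -> v l = \pi t ->
  d_term u v l = r%:R ^- l * (2 * `|sin (pi * (r%:R ^- l * (s - t)))|).
Proof.
rewrite /d_term => -> ->; rewrite !(phi_pi r_gt0) /phi_lift chordE.
congr (_ * (_ * `|sin _|)); move: (r%:R ^- l) => c; lra.
Qed.

Lemma d_term_le_d (u v : X R r) l : d_term u v l <= d u v.
Proof. by have [m [->]] := d_max hr u v. Qed.

Lemma A_coord a x l (s : R) :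
  iota_fun R x l = \pi_(modZ (r%:R ^+ l : R)) s ->
  Yval (A (a, x)) l = \pi_(modZ (r%:R ^+ l : R)) (a + s).
Proof.
move=> e; transitivity (\pi_(modZ (r%:R ^+ l : R)) a + iota_fun R x l) => //.
by rewrite e raddfD.
Qed.

(** When the coordinates of [x] and [y] are equal, a common representative
  cancels in the difference and only [a - b] is left. *)
Lemma d_term_agree a b x y l : iota_fun R x l = iota_fun R y l ->
  d_term (A (a, x)) (A (b, y)) l <= 2 * pi * `|a - b|.
Proof.
move=> e.
have es : iota_fun R x l =
    \pi_(modZ (r%:R ^+ l : R)) (repr (iota_fun R x l)) by rewrite reprK.
rewrite (d_term_pi _ _ _ _ _ (A_coord a _ _ _ es) (A_coord b _ _ _ (etrans (esym e) es))).
rewrite [b + _]addrC addrKA.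
have rl1 : 0 <= (r%:R ^- l : R) <= 1.
  by rewrite invr_ge0 exprn_ge0//= invf_le1 ?exprn_gt0// exprn_ege1.
case/andP: rl1 => rl0 rl1.
have p0 := pi_ge0 R.
apply: (@le_trans _ _ (1 * (2 * (pi * (1 * `|a - b|))))); last lra.
apply: ler_pM => //.
rewrite ler_pM2l//; apply: le_trans (norm_sin_le _ _) _.
rewrite !normrM (ger0_norm p0) (ger0_norm rl0) ler_wpM2l// ler_wpM2r//.
Qed.

(** The index [h] is counted from 0, so it stands for the level [h + 1]; this
  is why the exponent in [rho] is [h]. *)
Lemma rho_spec (x y : X0 r) :
  ((forall l, x l = y l) /\ rho R x y = 0) \/
  exists2 h, x h != y h & (forall l, (l < h)%N -> x l = y l) /\ rho R x y = r%:R ^- h.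
Proof.
rewrite /rho; case: asboolP => [->|xy]; first by left.
right; rewrite /ldiff; case: pselect => [ex|nex].
  case: ex_minnP => h xyh hmin; exists h => //; split.
    by move=> l lh; apply: contraTeq lh => /hmin; rewrite -leqNgt.
  rewrite (_ : 1 - _ = - h%:Z); last by rewrite -addn1 PoszD; lra.
  by rewrite exprnN.
case: xy; apply: functional_extensionality_dep => l.
by apply: contra_notP nex => /eqP; exists l.
Qed.

Lemma d_term_le_max a b x y h :
  (forall l, (l < h)%N -> Y0val x l = Y0val y l) ->
  forall l, d_term (A (a, x)) (A (b, y)) l <= Num.max (2 * pi * `|a - b|) (2 * r%:R ^- h).
Proof.
move=> agree l; rewrite le_max.
have [lh|lh] := leqP l h.
  apply/orP; left; apply: d_term_agree.
  by case: l lh => // l lh /=; rewrite agree.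
apply/orP; right; apply: le_trans (d_term_le _ _ _) _.
rewrite ler_pM2l// lef_pV2 ?posrE ?exprn_gt0//.
by rewrite ler_weXn2l// ltnW.
Qed.

(** At level 0 the embedded [x] and [y] both vanish. *)
Lemma dist_le_d a b x y : `|a - b| <= 1 / 2 -> 2 * `|a - b| <= d (A (a, x)) (A (b, y)).
Proof.
move=> ab; apply: le_trans (d_term_le_d _ _ 0).
have e0 z : iota_fun R z 0 = \pi_(modZ (r%:R ^+ 0 : R)) 0 by rewrite raddf0.
rewrite (d_term_pi _ _ _ _ _ (A_coord a _ _ _ (e0 x)) (A_coord b _ _ _ (e0 y))).
rewrite expr0 invr1 !mul1r !addr0 ler_pM2l//.
exact: norm_sin_pi_ge.
Qed.

(** The coordinate of index [h] is a class modulo [r^(h+1)], and its reduction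
  modulo [r^h] is the preceding coordinate, which agrees for [x] and [y].
  Quantifying over all representatives makes the bound one on the distance
  from [n - m] to the multiples of [r^(h+1)]. *)
Lemma first_diff_ge x y h :
  Y0val x h != Y0val y h -> (forall l, (l < h)%N -> Y0val x l = Y0val y l) ->
  forall n m, Y0val x h = \pi n -> Y0val y h = \pi m -> (r ^ h)%:R <= `|n - m|.
Proof.
move=> xyh agree n m xn ym.
have nm : n != m by apply: contraNneq xyh => nm; rewrite xn ym nm.
suff [j nmE] : exists j : int, n - m = r%:R ^+ h *~ j.
  rewrite nmE -mulrzr intz normrM natrX ger0_norm ?exprn_ge0// ler_peMr ?exprn_ge0//.
  rewrite -gtz0_ge1 normr_gt0; apply: contra_neq nm => j0.
  by apply/eqP; rewrite -subr_eq0 nmE j0 mulr0z.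
case: h => [|h] in xyh agree xn ym *; first by exists (n - m); rewrite expr0 intz.
have := agree h (leqnn _); rewrite (Y0P x) (Y0P y) xn ym !red0_pi.
by move=> /eqP/eq_modZP.
Qed.

(** Only the first level where [x] and [y] differ is used; there the chord is
  at least [1 / r]. *)
Lemma expn_le_d a b x y h : `|a - b| <= 1 / 2 ->
  Y0val x h != Y0val y h -> (forall l, (l < h)%N -> Y0val x l = Y0val y l) ->
  r%:R ^- h <= r%:R ^+ 2 * d (A (a, x)) (A (b, y)).
Proof.
move=> ab xyh agree.
set n := repr (Y0val x h); set m0 := repr (Y0val y h).
(* Adding [k r^(h+1)] to the representative of [y h] brings the angle into the
   range where the sine bound holds. *)
have [k hk] := exists_nearest_int _ (r%:R ^- h.+1 * (a - b + (n - m0)%:~R)).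
set m := m0 + r%:R ^+ h.+1 *~ k.
have xn : Y0val x h = \pi n by rewrite reprK.
have ym : Y0val y h = \pi m.
  rewrite -[Y0val y h]reprK; apply/eqP/eq_modZP; exists (- k).
  by rewrite /m opprD addNKr mulrNz.
have rh0 : r%:R ^+ h.+1 != 0 :> R by rewrite expf_neq0// gt_eqF.
have tE : r%:R ^- h.+1 * (a + n%:~R - (b + m%:~R)) =
    r%:R ^- h.+1 * (a - b + (n - m0)%:~R) - k%:~R.
  rewrite /m !rmorphB rmorphD /= intr_expMz -[_ *~ k]mulrzr.
  by field.
have := d_term_le_d (A (a, x)) (A (b, y)) h.+1.
have ex z (j : int) : Y0val z h = \pi j ->
    iota_fun R z h.+1 = \pi_(modZ (r%:R ^+ h.+1 : R)) j%:~R.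
  by move=> /= ->; rewrite incl_pi.
rewrite (d_term_pi _ _ _ _ _ (A_coord a _ _ _ (ex _ _ xn)) (A_coord b _ _ _ (ex _ _ ym))).
have := norm_sin_pi_ge _ _ hk; rewrite -tE.
have : 1 / (2 * r%:R) <= `|r%:R ^- h.+1 * (a + n%:~R - (b + m%:~R))|.
  have nm : r%:R ^+ h <= `|(n - m)%:~R : R|.
    rewrite -intr_norm -natrX -[(r ^ h)%:R]mulrz_nat ler_int.
    by rewrite natz -[Posz _]natz; apply: first_diff_ge xyh agree _ _ xn ym.
  have h1 : 1 <= r%:R ^+ h :> R by rewrite exprn_ege1.
  have -> : a + n%:~R - (b + m%:~R) = (a - b) + (n - m)%:~R :> R.
    by rewrite rmorphB /=; lra.
  rewrite normrM ger0_norm ?invr_ge0 ?exprn_ge0//.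
  (* [|a - b| <= 1/2 <= r^h / 2] takes away at most half of [|n - m|]. *)
  have t1 : r%:R ^+ h / 2 <= `|a - b + (n - m)%:~R|.
    have := lerB_normD ((n - m)%:~R : R) (a - b); rewrite [_%:~R + _]addrC.
    lra.
  rewrite [leRHS]mulrC ler_pdivlMr ?exprn_gt0// exprSr.
  apply: le_trans t1; rewrite le_eqVlt; apply/orP; left; apply/eqP.
  by field; rewrite gt_eqF.
set S := `|sin _| => h1 h2 h3.
have h4 : r%:R ^- h.+1 * (2 * (1 / (2 * r%:R))) <= d (A (a, x)) (A (b, y)).
  apply: le_trans h3; rewrite ler_pM2l ?invr_gt0 ?exprn_gt0// ler_pM2l//.
  exact: le_trans h1 h2.
have : r%:R ^+ 2 * (r%:R ^- h.+1 * (2 * (1 / (2 * r%:R)))) <= r%:R ^+ 2 * d (A (a, x)) (A (b, y)).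
  by rewrite ler_pM2l ?exprn_gt0.
apply: le_trans; rewrite le_eqVlt; apply/orP; left; apply/eqP.
by rewrite (exprS _ h); field; rewrite expf_neq0 gt_eqF.
Qed.

End Estimates.

Theorem mainTheorem1 (R : realType) (r : nat) (hr : (2 <= r)%N) :
  (forall (a b : R) (x y : Y0 r),
      d (A (a, x)) (A (b, y)) <= 2 * pi * D (a, x) (b, y)) /\
  (exists c2 : R, 0 < c2 /\
     forall (a b : R) (x y : Y0 r),
       `|a - b| <= 1 / 2 ->
       D (a, x) (b, y) <= c2 * d (A (a, x)) (A (b, y))).
Proof.
have p2 := pi_ge2 R.
split=> [a b x y|].
  have [l [-> _]] := d_max hr (A (a, x)) (A (b, y)).
  rewrite /D /= maxr_pMr; last by lra.
  have [[xy ->]|[h _ [agree ->]]] := rho_spec R r x y.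
    rewrite le_max; apply/orP; left; apply: d_term_agree => //.
    by case: l => //= l; rewrite xy.
  apply: le_trans (d_term_le_max R r hr a b x y h agree l) _.
  rewrite ge_max !le_max lexx /=; apply/orP; right.
  by rewrite ler_wpM2r ?invr_ge0 ?exprn_ge0//; lra.
have r2 : 1 <= r%:R ^+ 2 :> R by rewrite exprn_ege1// ler1n ltnW.
exists (r%:R ^+ 2); split; first by lra.
move=> a b x y ab; rewrite /D /= ge_max.
have h0 := dist_le_d R r hr a b x y ab.
have ab0 := normr_ge0 (a - b).
have h1 : `|a - b| <= r%:R ^+ 2 * d (A (a, x)) (A (b, y)).
  have : 1 * d (A (a, x)) (A (b, y)) <= r%:R ^+ 2 * d (A (a, x)) (A (b, y)).
    by rewrite ler_wpM2r//; lra.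
  lra.
rewrite h1 /=.
have [[_ ->]|[h xyh [agree ->]]] := rho_spec R r x y; first exact: le_trans h1.
exact: expn_le_d.
Qed.
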